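(* Let $\pi$ be a permutation of $\mathbb{F}_2^m$. If $\pi$ has the property $(P_1)$, then it also has the property $(P_2)$.
   Context: For $F\colon\mathbb{F}_2^m\to\mathbb{F}_2^m$ and $a,b\in\mathbb{F}_2^m$: $D_aF(y)=F(y+a)+F(y)$ and $D_aD_bF(y)=F(y+a+b)+F(y+a)+F(y+b)+F(y)$. $0_m$ denotes the zero vector; $D_aD_bF=0_m$ means the function is identically $0_m$, and $D_aD_bF\neq 0_m$ means it is not the constant zero function. $v\cdot w=\sum_i v_iw_i$ is the standard scalar product over $\mathbb{F}_2$. Property $(P_1)$: $D_vD_w\pi\neq 0_m$ for all linearly independent $v,w\in\mathbb{F}_2^m$. Property $(P_2)$ with respect to $S$: let $S$ be a subspace of $\mathbb{F}_2^m$ with $1\le\dim(S)\le m-1$ such that $D_aD_b\pi=0_m$ for all $a,b\in S$. Then $\pi$ satisfies $(P_2)$ with respect to $S$ if there does not exist a linear subspace $V$ of $\mathbb{F}_2^m$ with $\dim(V)=m-\dim(S)$ such that $v\cdot D_a\pi(y)=0$ for all $a\in S$, all $y\in\mathbb{F}_2^m$ and all $v\in V$. If $\pi$ satisfies $(P_2)$ with respect to every subspace $S$ with $1\le\dim(S)\le m-1$ such that $D_aD_b\pi=0_m$ for all $a,b\in S$, then $\pi$ is said to satisfy $(P_2)$. *)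

(* Defs.v *)
From mathcomp Require Import all_boot all_order all_algebra all_fingroup.

Set Implicit Arguments.
Unset Strict Implicit.
Unset Printing Implicit Defensive.

Import GRing.Theory.
Local Open Scope ring_scope.

Definition dotprod (m : nat) (v w : 'rV['F_2]_m) : 'F_2 :=
  \sum_(i < m) v 0 i * w 0 i.

Definition D1 (m : nat) (a : 'rV['F_2]_m) (F : 'rV['F_2]_m -> 'rV['F_2]_m)
    (y : 'rV['F_2]_m) : 'rV['F_2]_m :=
  F (y + a) + F y.

Definition D2 (m : nat) (a b : 'rV['F_2]_m) (F : 'rV['F_2]_m -> 'rV['F_2]_m)
    (y : 'rV['F_2]_m) : 'rV['F_2]_m :=
  F (y + a + b) + F (y + a) + F (y + b) + F y.

Definition D2_vanishes (m : nat) (a b : 'rV['F_2]_m)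
    (F : 'rV['F_2]_m -> 'rV['F_2]_m) : Prop :=
  forall y : 'rV['F_2]_m, D2 a b F y = 0.

Definition property_P1 (m : nat) (F : 'rV['F_2]_m -> 'rV['F_2]_m) : Prop :=
  forall v w : 'rV['F_2]_m, free [:: v; w] -> ~ D2_vanishes v w F.

Definition P2_admissible (m : nat) (F : 'rV['F_2]_m -> 'rV['F_2]_m)
    (S : {vspace 'rV['F_2]_m}) : Prop :=
  (1 <= \dim S <= m - 1)%N /\
  (forall a b : 'rV['F_2]_m, a \in S -> b \in S -> D2_vanishes a b F).

(* Only meaningful when [P2_admissible F S], which also makes the truncated
   subtraction below the true codimension. *)
Definition property_P2_wrt (m : nat) (F : 'rV['F_2]_m -> 'rV['F_2]_m)
    (S : {vspace 'rV['F_2]_m}) : Prop :=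
  ~ exists V : {vspace 'rV['F_2]_m},
      \dim V = (m - \dim S)%N /\
      (forall a y v : 'rV['F_2]_m,
          a \in S -> v \in V -> dotprod v (D1 a F y) = 0).

Definition property_P2 (m : nat) (F : 'rV['F_2]_m -> 'rV['F_2]_m) : Prop :=
  forall S : {vspace 'rV['F_2]_m}, P2_admissible F S -> property_P2_wrt F S.

(* Main.v *)
Require Import Defs.
From mathcomp Require Import all_boot all_order all_algebra all_fingroup.

(** Let [S] be admissible for [P2]. If [S] contained two independent vectors,
    their second derivative would vanish, against [P1]; hence [S] is a line
    [<[a]>], and a space [V] refuting [P2] with respect to [S] is a hyperplane.
    All the values of [D_a pi] are orthogonal to [V], and they are nonzero
    because [pi] is injective. Over [F_2] a hyperplane has exactly one nonzero
    normal vector ([hyperplane_normal_unique]), so [D_a pi] is constant, and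
    [D_a D_b pi = 0] for every [b]. As [dim S < m], some [b] is independent of
    [a], which contradicts [P1] again. *)

Set Implicit Arguments.
Unset Strict Implicit.

Import GRing.Theory.
Local Open Scope ring_scope.

Lemma dotprodDl (m : nat) (u v x : 'rV['F_2]_m) :
  dotprod (u + v) x = dotprod u x + dotprod v x.
Proof.
by rewrite /dotprod -big_split; apply: eq_bigr => i _; rewrite mxE mulrDl.
Qed.

Lemma dotprodZl (m : nat) (k : 'F_2) (v x : 'rV['F_2]_m) :
  dotprod (k *: v) x = k * dotprod v x.
Proof.
by rewrite /dotprod mulr_sumr; apply: eq_bigr => i _; rewrite mxE mulrA.
Qed.

Lemma dotprod_delta (m : nat) (i : 'I_m) (x : 'rV['F_2]_m) :
  dotprod (delta_mx 0 i) x = x 0 i.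
Proof.
rewrite /dotprod (bigD1 i) //= mxE !eqxx mul1r big1 ?addr0 // => j /negPf ji.
by rewrite mxE ji andbF mul0r.
Qed.

Lemma F2_neq0 (k : 'F_2) : k != 0 -> k = 1.
Proof. by case: k => [[|[|k]] Hk] // _; apply/val_inj. Qed.

Lemma F2_addvv (m : nat) (x : 'rV['F_2]_m) : x + x = 0.
Proof. by rewrite -mulr2n -scaler_nat pchar_Zp // scale0r. Qed.

(** Otherwise [V] and some [v] outside [V] orthogonal to [x] would together
    span the whole space, making [x] orthogonal to every vector. *)
Lemma mem_hyperplane (m : nat) (V : {vspace 'rV['F_2]_m}) (x : 'rV['F_2]_m) :
  (m <= (\dim V).+1)%N -> x != 0 ->
  (forall v, v \in V -> dotprod v x = 0) ->
  forall v, (v \in V) = (dotprod v x == 0).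
Proof.
move=> dimV x_neq0 Vx v; apply/idP/eqP => [/Vx // | vx].
apply/negPn/negP => vV; case/eqP: x_neq0.
have full : (V + <[v]>)%VS = fullv.
  apply/eqP; rewrite eqEdim subvf dimvf /dim /= mul1n.
  apply: leq_trans dimV _; rewrite ltnNge; apply/negP => le_dim.
  case/negP: vV; have /eqP-> : V == (V + <[v]>)%VS by rewrite eqEdim addvSl.
  by rewrite memvE addvSr.
apply/rowP => i; rewrite mxE -dotprod_delta.
have : delta_mx 0 i \in (V + <[v]>)%VS by rewrite full memvf.
case/memv_addP=> u uV [_ /vlineP[k ->] ->].
by rewrite dotprodDl dotprodZl (Vx u uV) vx mulr0 addr0.
Qed.

(** Two nonzero normals define functionals with the same kernel [V], and an
    [F_2]-valued functional is determined by its kernel. *)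
Lemma hyperplane_normal_unique (m : nat) (V : {vspace 'rV['F_2]_m})
    (x y : 'rV['F_2]_m) :
  (m <= (\dim V).+1)%N -> x != 0 -> y != 0 ->
  (forall v, v \in V -> dotprod v x = 0) ->
  (forall v, v \in V -> dotprod v y = 0) -> x = y.
Proof.
move=> dimV x0 y0 Vx Vy; apply/rowP => i; rewrite -!dotprod_delta.
have := mem_hyperplane dimV x0 Vx (delta_mx 0 i).
rewrite (mem_hyperplane dimV y0 Vy).
by have [->|/F2_neq0->] := eqVneq (dotprod _ y) 0;
   have [->|/F2_neq0->] := eqVneq (dotprod _ x) 0.
Qed.

Lemma D1_inj_neq0 (m : nat) (F : 'rV['F_2]_m -> 'rV['F_2]_m)
    (a y : 'rV['F_2]_m) :
  injective F -> a != 0 -> D1 a F y != 0.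
Proof.
move=> injF; apply: contraNneq => DF0.
have /injF /eqP : F (y + a) = F y.
  by rewrite -[F (y + a)]addr0 -(F2_addvv (F y)) addrA -/(D1 a F y) DF0 add0r.
by rewrite -subr_eq0 addrC addKr.
Qed.

Lemma D2_D1 (m : nat) (F : 'rV['F_2]_m -> 'rV['F_2]_m)
    (a b y : 'rV['F_2]_m) :
  D2 b a F y = D1 a F (y + b) + D1 a F y.
Proof. by rewrite /D2 /D1 addrA. Qed.

Lemma free_pair (m : nat) (a b : 'rV['F_2]_m) :
  a != 0 -> b \notin <[a]>%VS -> free [:: b; a].
Proof. by move=> a0 ba; rewrite free_cons span_seq1 ba seq1_free. Qed.

Unset Implicit Arguments.

Theorem proposition3p9 (m : nat) (pi : {perm 'rV['F_2]_m}) :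
  property_P1 pi -> property_P2 pi.
Proof.
move=> P1 S [/andP[dimS_gt0 dimS_lt] D2S] [V [dimV orthV]].
have a0 : vpick S != 0 by rewrite vpick0 -dimv_eq0 -lt0n.
have := memv_pick S; set a := vpick S in a0 *; move=> aS.
have S_line : (S <= <[a]>)%VS.
  apply/subvP => b bS; apply/negPn/negP => /(free_pair a0) /P1.
  by apply; apply: D2S.
have dimS : \dim S = 1%N.
  apply/eqP; rewrite eqn_leq dimS_gt0 andbT.
  by apply: leq_trans (dimvS S_line) _; rewrite dim_vline; case: (a != 0).
have [b _ /(free_pair a0) /P1] :
    exists2 b, b \in fullv & b \notin <[a]>%VS.
  apply/subvPn/negP => /dimvS; rewrite dimvf /dim /= mul1n dim_vline a0 => m_le1.
  by move: dimS_lt; rewrite dimS leqNgt ltnS leq_subLR addn0 m_le1.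
apply=> y; rewrite D2_D1.
have -> : D1 a pi (y + b) = D1 a pi y; last exact: F2_addvv.
apply: (@hyperplane_normal_unique _ V).
- by rewrite dimV dimS subn1 leqSpred.
- exact: D1_inj_neq0 perm_inj a0.
- exact: D1_inj_neq0 perm_inj a0.
- by move=> v; apply: orthV.
- by move=> v; apply: orthV.
Qed.
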